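(* (i) Let $\mathfrak B$ be a nondegenerate super-commutative $2$-cocycle on a multiplicative Hom-Lie superalgebra $(\mathcal A,[\cdot,\cdot],\alpha)$ satisfying $\mathfrak B(\alpha(x),\alpha(y))=\mathfrak B(x,y)$ for all homogeneous $x,y\in\mathcal A$. Then there exists a compatible Hom-anti-pre-Lie superalgebra structure $\circ$ on $(\mathcal A,[\cdot,\cdot],\alpha)$ given by $$\mathfrak B(x\circ y,\alpha(z))=(-1)^{|x||y|}\,\mathfrak B(\alpha(y),[x,z])$$ for all homogeneous $x,y,z\in\mathcal A$. (ii) Conversely, let $(\mathcal A,\circ,\alpha)$ be a multiplicative Hom-anti-pre-Lie superalgebra with $\alpha$ bijective, and let $(\mathcal A,[\cdot,\cdot],\alpha)$, $[x,y]=x\circ y-(-1)^{|x||y|}y\circ x$, be its sub-adjacent Hom-Lie superalgebra. Then the natural nondegenerate supersymmetric bilinear form $\mathfrak B_d$ on $\mathcal A\oplus\mathcal A^*$ is a super-commutative $2$-cocycle on the Hom-Lie superalgebra $\mathcal A\ltimes_{-\mathfrak L_\circ^\star}\mathcal A^*$.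
   Context: All vector spaces are finite-dimensional over a field $\mathbb K$ of characteristic $0$. Superspaces are $\mathbb Z_2$-graded, $|x|$ is the parity of a homogeneous element $x$, and identities are required for homogeneous elements. Even maps preserve parity. A Hom-Lie superalgebra is a triple $(\mathcal A,[\cdot,\cdot],\alpha)$ with $[\cdot,\cdot]$ an even bilinear map and $\alpha$ an even linear map on a $\mathbb Z_2$-graded vector space $\mathcal A$ such that $[x,y]=-(-1)^{|x||y|}[y,x]$ and $[\alpha(x),[y,z]]=[[x,y],\alpha(z)]+(-1)^{|x||y|}[\alpha(y),[x,z]]$. It is multiplicative if $\alpha([x,y])=[\alpha(x),\alpha(y)]$. A Hom-anti-pre-Lie superalgebra is a triple $(\mathcal A,\circ,\alpha)$ with $\circ$ an even bilinear map and $\alpha$ an even linear map such that, with $[x,y]_\circ=x\circ y-(-1)^{|x||y|}y\circ x$, $\alpha(x)\circ(y\circ z)-(-1)^{|x||y|}\alpha(y)\circ(x\circ z)=(-1)^{|x||y|}[y,x]_\circ\circ\alpha(z)$ and $[x,y]_\circ\circ\alpha(z)+(-1)^{|x|(|y|+|z|)}[y,z]_\circ\circ\alpha(x)+(-1)^{|z|(|x|+|y|)}[z,x]_\circ\circ\alpha(y)=0$. It is multiplicative if $\alpha(x\circ y)=\alpha(x)\circ\alpha(y)$. Then $(\mathcal A,[\cdot,\cdot]_\circ,\alpha)$ is a Hom-Lie superalgebra, called sub-adjacent; $(\mathcal A,\circ,\alpha)$ is compatible with $(\mathcal A,[\cdot,\cdot],\alpha)$ if $[\cdot,\cdot]_\circ=[\cdot,\cdot]$.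 A super-commutative $2$-cocycle on $(\mathcal A,[\cdot,\cdot],\alpha)$ is an even bilinear form $\mathfrak B:\mathcal A\times\mathcal A\to\mathbb K$ (i.e. $\mathfrak B(\mathcal A_{\bar 0},\mathcal A_{\bar 1})=\mathfrak B(\mathcal A_{\bar 1},\mathcal A_{\bar 0})=0$) with $\mathfrak B(x,y)=(-1)^{|x||y|}\mathfrak B(y,x)$ and $\mathfrak B(\alpha(x),[y,z])+(-1)^{|x|(|y|+|z|)}\mathfrak B(\alpha(y),[z,x])+(-1)^{|z|(|x|+|y|)}\mathfrak B(\alpha(z),[x,y])=0$. For $\alpha$ bijective, $\mathfrak L_\circ^\star:\mathcal A\to gl(\mathcal A^* )$ is given by $\langle\mathfrak L_\circ^\star(x)\xi,v\rangle=-(-1)^{|x||\xi|}\langle\xi,\alpha^{-1}(x)\circ\alpha^{-2}(v)\rangle$, and $(\alpha^{-1})^*$ is the transpose of $\alpha^{-1}$. The superalgebra $\mathcal A\ltimes_{-\mathfrak L_\circ^\star}\mathcal A^*$ is $\mathcal A\oplus\mathcal A^*$ with twisting map $\alpha\oplus(\alpha^{-1})^*$ and bracket $[x+\xi,y+\zeta]=[x,y]-\mathfrak L_\circ^\star(x)\zeta+(-1)^{|y||\xi|}\mathfrak L_\circ^\star(y)\xi$. The natural form is $\mathfrak B_d(x+\xi,y+\zeta)=\langle x,\zeta\rangle+\langle\xi,y\rangle$, where $\langle\xi,y\rangle=\xi(y)$ and $\langle x,\zeta\rangle=(-1)^{|x||\zeta|}\zeta(x)$. *)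

(* Defs.v *)
From HB Require Import structures.
From mathcomp Require Export all_boot all_order all_algebra.
From mathcomp Require Export sesquilinear.
Set Implicit Arguments.
Unset Strict Implicit.
Unset Printing Implicit Defensive.
Import GRing.Theory.
Local Open Scope ring_scope.

(* A parity is a boolean ([false] is even, [true] is odd), so that parities add
   by [addb] and the exponent |x||y| is [i && j]. *)
HB.mixin Record Vector_isSuper (K : fieldType) V of Vector K V := {
  grade : bool -> {vspace V};
  grade_add : (grade false + grade true)%VS = fullv;
  grade_cap : (grade false :&: grade true)%VS = 0%VS
}.

#[short(type="superVectType")]
HB.structure Definition SuperVector (K : fieldType) :=
  {V of Vector K V & Vector_isSuper K V}.

Section HomogeneousComponents.
Variables (K : fieldType) (V : superVectType K).

Definition hcomp (i : bool) : 'End(V) :=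
  daddv_pi (grade i : {vspace V}) (grade (~~ i)).

Lemma grade_capC i : (grade i :&: (grade (~~ i) : {vspace V}) = 0)%VS.
Proof. by case: i; rewrite /= ?grade_cap // capvC grade_cap. Qed.

Lemma grade_addC i : (grade i + (grade (~~ i) : {vspace V}) = fullv)%VS.
Proof. by case: i; rewrite /= ?grade_add // addvC grade_add. Qed.

Lemma hcomp_grade i v : hcomp i v \in (grade i : {vspace V}).
Proof. exact: memv_pi. Qed.

Lemma hcomp_sum v : hcomp false v + hcomp true v = v.
Proof.
by apply: daddv_pi_add; rewrite ?(grade_capC false) ?(grade_addC false) ?memvf.
Qed.

Lemma hcompE i j v :
  v \in (grade j : {vspace V}) -> hcomp i v = if i == j then v else 0.
Proof.
have hid k u : u \in (grade k : {vspace V}) -> hcomp k u = u.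
  by move=> uk; apply: daddv_pi_id => //; apply: grade_capC.
move=> vj; case: eqP => [->|/eqP nij]; first exact: hid.
have := hcomp_sum v; have hj := hid _ _ vj.
case: i j nij hj {vj} => -[] // _ ->; last by move/(canRL (addrK _))->; rewrite subrr.
by rewrite addrC => /(canRL (addrK _))->; rewrite subrr.
Qed.

End HomogeneousComponents.

Arguments hcomp {K V} i.

Definition ksign {K : fieldType} (i j : bool) : K := (-1) ^+ (i && j).

(* The extension to all vectors of the expression (-1)^(|v||w|) f(v, w), which
   only makes sense for homogeneous v and w (see [koszulE]). *)
Definition koszul (K : fieldType) (V W : superVectType K) (U : lmodType K)
    (f : V -> W -> U) (v : V) (w : W) : U :=
  \sum_(i : bool) \sum_(j : bool) ksign i j *: f (hcomp i v) (hcomp j w).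

Lemma koszulE (K : fieldType) (V W : superVectType K) (U : lmodType K)
    (f : V -> W -> U) i j v w :
  bilinear_for *:%R *:%R f -> v \in (grade i : {vspace V}) ->
  w \in (grade j : {vspace W}) -> koszul f v w = ksign i j *: f v w.
Proof.
move=> [fl fr] vi wj.
have f0l y : f 0 y = 0 by have /= := fl y (-1) 0 0; rewrite !scaleN1r !addNr.
have f0r x : f x 0 = 0 by have /= := fr x (-1) 0 0; rewrite !scaleN1r !addNr.
rewrite /koszul (bigD1 i) //= (bigD1 j) //= !(hcompE _ vi) !(hcompE _ wj) !eqxx.
rewrite !big1 ?addr0 // => k /negPf nk; last by rewrite (hcompE _ wj) nk f0r scaler0.
by rewrite big1 // => l _; rewrite (hcompE _ vi) nk f0l scaler0.
Qed.

Section DualSuperspace.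
Variables (K : fieldType) (V : superVectType K).

Definition dualv : Type := 'Hom(V, K^o).
HB.instance Definition _ := Vector.on dualv.

Definition restr_graded (i : bool) (xi : dualv) : dualv :=
  (xi \o projv (grade i : {vspace V}))%VF.

Fact restr_graded_linear i : linear (restr_graded i).
Proof. by move=> a x y; rewrite /restr_graded comp_lfunDl comp_lfunZl. Qed.
HB.instance Definition _ i :=
  GRing.isLinear.Build K dualv dualv *:%R (restr_graded i) (restr_graded_linear i).

(* The forms of parity i are those vanishing on the vectors of the opposite
   parity (see [mem_dual_grade]). *)
Definition dual_grade (i : bool) : {vspace dualv} :=
  lker (linfun (restr_graded (~~ i))).

Lemma mem_dual_grade i (xi : dualv) :
  reflect (forall v, v \in (grade (~~ i) : {vspace V}) -> xi v = 0)
          (xi \in dual_grade i).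
Proof.
rewrite memv_ker lfunE; apply: (iffP eqP) => [xi0 v vi | xi0].
  by have /lfunP/(_ v) := xi0; rewrite !lfunE /= projv_id // lfunE.
by apply/lfunP => v; rewrite !lfunE /= xi0 ?memv_proj // lfunE.
Qed.

Fact dual_grade_add : (dual_grade false + dual_grade true)%VS = fullv.
Proof.
apply/vspaceP => xi; rewrite memvf.
have -> : xi = ((xi : 'Hom(V, K^o)) \o hcomp false)%VF
             + ((xi : 'Hom(V, K^o)) \o hcomp true)%VF.
  by apply/lfunP => v; rewrite !lfunE /= !lfunE /= -linearD hcomp_sum.
by apply: memv_add; apply/mem_dual_grade => v vi;
  rewrite lfunE /= (hcompE _ vi) linear0.
Qed.

Fact dual_grade_cap : (dual_grade false :&: dual_grade true)%VS = 0%VS.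
Proof.
apply/eqP; rewrite -subv0; apply/subvP => xi.
rewrite memv_cap memv0 => /andP[/mem_dual_grade x1 /mem_dual_grade x0].
apply/eqP/lfunP => v; rewrite -(hcomp_sum v) linearD /=.
by rewrite x0 ?x1 ?hcomp_grade // addr0 lfunE.
Qed.

HB.instance Definition _ :=
  Vector_isSuper.Build K dualv dual_grade_add dual_grade_cap.

End DualSuperspace.

Section DirectSumSuperspace.
Variables (K : fieldType) (V W : superVectType K).

Definition pair_grade (i : bool) : {vspace (V * W)%type} :=
  (linfun (fst : V * W -> V) @^-1: grade i
   :&: linfun (snd : V * W -> W) @^-1: grade i)%VS.

Lemma mem_pair_grade i (p : V * W) :
  (p \in pair_grade i) = (p.1 \in (grade i : {vspace V}))
                         && (p.2 \in (grade i : {vspace W})).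
Proof. by rewrite memv_cap -!memv_preim !lfunE. Qed.

Fact pair_grade_add : (pair_grade false + pair_grade true)%VS = fullv.
Proof.
apply/vspaceP => p; rewrite memvf.
have -> : p = (hcomp false p.1, hcomp false p.2) + (hcomp true p.1, hcomp true p.2).
  by case: p => v w; congr pair; rewrite hcomp_sum.
by apply: memv_add; rewrite mem_pair_grade !hcomp_grade.
Qed.

Fact pair_grade_cap : (pair_grade false :&: pair_grade true)%VS = 0%VS.
Proof.
apply/eqP; rewrite -subv0; apply/subvP => -[v w].
rewrite memv_cap !mem_pair_grade memv0 /= => /andP[/andP[v0 w0] /andP[v1 w1]].
have: v \in (grade false :&: grade true : {vspace V})%VS by rewrite memv_cap v0.
have: w \in (grade false :&: grade true : {vspace W})%VS by rewrite memv_cap w0.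
by rewrite !grade_cap !memv0 => /eqP-> /eqP->.
Qed.

HB.instance Definition _ :=
  Vector_isSuper.Build K (V * W)%type pair_grade_add pair_grade_cap.

End DirectSumSuperspace.

Notation "x \hom i" := (x \in (grade i : {vspace _}))
  (at level 70, i at level 69, no associativity) : ring_scope.

Section Structures.
Variables (K : fieldType) (A : superVectType K).
Implicit Types (op br : A -> A -> A) (al : A -> A) (B : A -> A -> K).

Definition even_linear al : Prop :=
  linear al /\ forall i x, x \hom i -> al x \hom i.

Definition even_bilinear op : Prop :=
  bilinear_for *:%R *:%R op /\
  forall i j x y, x \hom i -> y \hom j -> op x y \hom (i (+) j).

Definition even_form B : Prop :=
  bilinear_for *%R *%R B /\
  forall i x y, x \hom i -> y \hom (~~ i) -> B x y = 0.

Definition hom_multiplicative op al : Prop :=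
  forall i j x y, x \hom i -> y \hom j -> al (op x y) = op (al x) (al y).

Record hom_lie br al : Prop := HomLie {
  hom_lie_br : even_bilinear br;
  hom_lie_al : even_linear al;
  hom_lie_skew : forall i j x y, x \hom i -> y \hom j ->
    br x y = - (ksign i j *: br y x);
  hom_lie_jacobi : forall i j k x y z, x \hom i -> y \hom j -> z \hom k ->
    br (al x) (br y z) = br (br x y) (al z) + ksign i j *: br (al y) (br x z)
}.

(* [x, y] = x o y - (-1)^(|x||y|) y o x *)
Definition subadj op (x y : A) : A := op x y - koszul op y x.

Record hom_anti_pre_lie op al : Prop := HomAntiPreLie {
  hapl_op : even_bilinear op;
  hapl_al : even_linear al;
  hapl_left : forall i j k x y z, x \hom i -> y \hom j -> z \hom k ->
    op (al x) (op y z) - ksign i j *: op (al y) (op x z)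
    = ksign i j *: op (subadj op y x) (al z);
  hapl_cyclic : forall i j k x y z, x \hom i -> y \hom j -> z \hom k ->
    op (subadj op x y) (al z)
    + ksign i (j (+) k) *: op (subadj op y z) (al x)
    + ksign k (i (+) j) *: op (subadj op z x) (al y) = 0
}.

Definition compatible op br : Prop := forall x y, subadj op x y = br x y.

Record super_comm_cocycle br al B : Prop := SuperCommCocycle {
  scc_even : even_form B;
  scc_sym : forall i j x y, x \hom i -> y \hom j -> B x y = ksign i j * B y x;
  scc_cocycle : forall i j k x y z, x \hom i -> y \hom j -> z \hom k ->
    B (al x) (br y z) + ksign i (j (+) k) * B (al y) (br z x)
    + ksign k (i (+) j) * B (al z) (br x y) = 0
}.

Definition nondegenerate_form B : Prop :=
  (forall x, (forall y, B x y = 0) -> x = 0) /\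
  (forall y, (forall x, B x y = 0) -> y = 0).

End Structures.

Section Semidirect.
Variables (K : fieldType) (A : superVectType K).
Variables (op : A -> A -> A) (al : 'End(A)).

(* <L*(x) xi, v> = - (-1)^(|x||xi|) <xi, al^-1(x) o al^-2(v)>; the function
   [linfun (op u)] is the left multiplication v |-> u o v. *)
Definition Lstar (x : A) (xi : dualv A) : dualv A :=
  - koszul (fun (u : A) (eta : dualv A) =>
      ((eta : 'Hom(A, K^o)) \o linfun (op (al^-1%VF u)) \o (al^-1 \o al^-1))%VF
      : dualv A) x xi.

Lemma LstarE i j (x : A) (xi : dualv A) (v : A) :
  even_bilinear op -> x \hom i -> xi \hom j ->
  Lstar x xi v
  = - (ksign i j * xi (op (al^-1%VF x) (al^-1%VF (al^-1%VF v)))).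
Proof.
move=> [[fl fr] _] x_i xi_j.
have lf u w : linfun (op u) w = op u w.
  pose h := GRing.isLinear.Build K A A *:%R (op u) (fr u).
  pose F : {linear A -> A} := HB.pack (op u) h.
  by rewrite -[op u]/(F : A -> A) lfunE.
rewrite /Lstar (koszulE _ x_i xi_j) ?opp_lfunE ?scale_lfunE /= ?comp_lfunE ?lf //.
split=> [eta|u] a y z; apply/lfunP => w; rewrite !lfunE /= ?lfunE /= ?lf ?linearP //.
  by rewrite fl linearP !comp_lfunE !lf.
by rewrite !lfunE /= !lfunE /= !lf.
Qed.

Definition semi_al (p : A * dualv A) : A * dualv A :=
  (al p.1, ((p.2 : 'Hom(A, K^o)) \o al^-1)%VF).

(* Homogeneous elements p = x + xi and q = y + zeta have |p| = |x| = |xi| and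
   |q| = |y| = |zeta|. *)
Definition semi_br (p q : A * dualv A) : A * dualv A :=
  (subadj op p.1 q.1, - Lstar p.1 q.2 + koszul Lstar q.1 p.2).

End Semidirect.

(* <x, zeta> + <xi, y> with <x, zeta> = (-1)^(|x||zeta|) zeta(x) *)
Definition natural_form (K : fieldType) (A : superVectType K)
    (p q : A * dualv A) : K :=
  koszul (fun (x : A) (zeta : dualv A) => zeta x) p.1 q.2
  + (p.2 : 'Hom(A, K^o)) q.1.

Lemma natural_formE (K : fieldType) (A : superVectType K) i j (p q : A * dualv A) : p \hom i -> q \hom j ->
  natural_form p q = ksign i j * q.2 p.1 + p.2 q.1.
Proof.
rewrite !mem_pair_grade => /andP[a _] /andP[_ b]; rewrite /natural_form (koszulE _ a b) //.
split=> [u|u] k y z /=; by rewrite ?linearP // !lfunE /= ?lfunE.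
Qed.

(* Main.v *)
(* (i) B is al-invariant and nondegenerate, hence al is bijective and the formula
   defines a product o whose commutator is the bracket by the cocycle condition.
   Paired with al^2(w), the left identity of o is the Jacobi identity; the
   cyclic sum of [x, y] o al(z) pairs to a scalar T that the cocycle condition
   and the Jacobi identity, used in the two possible orders, evaluate to
   opposite values, so 2 T = 0.
   (ii) By the left identity -L* is a representation of the sub-adjacent
   algebra, so the semidirect product is a Hom-Lie superalgebra. Expanding the
   cocycle condition for the natural form, the terms in which a given dual
   vector occurs are its values at [y, z] - y o z + (-1)^(|y||z|) z o y = 0. *)
From HB Require Import structures.
Require Import Defs.
From mathcomp Require Import all_boot all_order all_algebra.
From mathcomp Require Import ring.
Set Implicit Arguments.
Unset Strict Implicit.
Unset Printing Implicit Defensive.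
Import GRing.Theory.
Local Open Scope ring_scope.

(** * Koszul signs *)

Section Signs.
Variable K : fieldType.

Lemma ksign0n j : ksign false j = 1 :> K. Proof. by []. Qed.
Lemma ksignn0 i : ksign i false = 1 :> K. Proof. by case: i. Qed.
Lemma ksign11 : ksign true true = - 1 :> K. Proof. by rewrite /ksign expr1. Qed.
Definition ksignE := (ksign0n, ksignn0, ksign11).

Lemma ksignC i j : ksign i j = ksign j i :> K.
Proof. by rewrite /ksign andbC. Qed.

(** Passed to [ring:] for each pair of parities involved, this settles sign bookkeeping without case
    analysis. *)
Lemma ksignK i j : ksign i j * ksign i j = 1 :> K.
Proof. by case: i j => -[]; rewrite !ksignE ?mulrNN mulr1. Qed.

Lemma ksignDr i j k : ksign i (j (+) k) = ksign i j * ksign i k :> K.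
Proof. by case: i j k => -[] -[]; rewrite /= !ksignE; ring. Qed.

Lemma ksignDl i j k : ksign (i (+) j) k = ksign i k * ksign j k :> K.
Proof. by rewrite ksignC ksignDr !(ksignC k). Qed.

End Signs.

Arguments ksignC {K} i j.
Arguments ksignK {K} i j.

(** * Bilinear maps *)

Section Bilinear.
Variables (K : fieldType) (V W U : lmodType K) (f : V -> W -> U).
Hypothesis fb : bilinear_for *:%R *:%R f.

Lemma bilDl x y w : f (x + y) w = f x w + f y w.
Proof. by have /= := fb.1 w 1 x y; rewrite !scale1r. Qed.

Lemma bilDr v x y : f v (x + y) = f v x + f v y.
Proof. by have /= := fb.2 v 1 x y; rewrite !scale1r. Qed.

Lemma bil0l w : f 0 w = 0.
Proof. by have /= := fb.1 w (-1) 0 0; rewrite !scaleN1r !addNr. Qed.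

Lemma bil0r v : f v 0 = 0.
Proof. by have /= := fb.2 v (-1) 0 0; rewrite !scaleN1r !addNr. Qed.

Lemma bilZl a x w : f (a *: x) w = a *: f x w.
Proof. by have /= := fb.1 w a x 0; rewrite bil0l !addr0. Qed.

Lemma bilZr a v x : f v (a *: x) = a *: f v x.
Proof. by have /= := fb.2 v a x 0; rewrite bil0r !addr0. Qed.

Lemma bilNl x w : f (- x) w = - f x w.
Proof. by rewrite -scaleN1r bilZl scaleN1r. Qed.

Lemma bilNr v x : f v (- x) = - f v x.
Proof. by rewrite -scaleN1r bilZr scaleN1r. Qed.

Lemma bilinear_flip : bilinear_for *:%R *:%R (fun w v => f v w).
Proof. by split; [exact: fb.2 | exact: fb.1]. Qed.

End Bilinear.

Lemma bilinearB (K : fieldType) (V W U : lmodType K) (f g : V -> W -> U) :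
  bilinear_for *:%R *:%R f -> bilinear_for *:%R *:%R g ->
  bilinear_for *:%R *:%R (fun v w => f v w - g v w).
Proof.
by move=> fb gb; split=> w a x y /=;
  rewrite ?(bilDl fb, bilZl fb, bilDl gb, bilZl gb)
    ?(bilDr fb, bilZr fb, bilDr gb, bilZr gb) scalerBr opprD addrACA.
Qed.

Lemma bilinearN (K : fieldType) (V W U : lmodType K) (f : V -> W -> U) :
  bilinear_for *:%R *:%R f -> bilinear_for *:%R *:%R (fun v w => - f v w).
Proof.
by move=> fb; split=> w a x y /=;
  rewrite ?(bilDl fb, bilZl fb) ?(bilDr fb, bilZr fb) scalerN opprD.
Qed.

(** * Homogeneous components and parity *)

Section Homogeneous.
Variables (K : fieldType) (V W : superVectType K).

Lemma koszul_bilinear (U : lmodType K) (f : V -> W -> U) :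
  bilinear_for *:%R *:%R f -> bilinear_for *:%R *:%R (koszul f).
Proof.
move=> fb; split=> w a x y; rewrite /koszul /= scaler_sumr -big_split;
  apply: eq_bigr => i _ /=; rewrite scaler_sumr -big_split;
  apply: eq_bigr => j _ /=.
  by rewrite linearP /= (bilDl fb) (bilZl fb) scalerDr !scalerA [a * _]mulrC.
by rewrite linearP /= (bilDr fb) (bilZr fb) scalerDr !scalerA [a * _]mulrC.
Qed.

(** Carries identities required only for homogeneous vectors, such as multiplicativity, to all
    vectors. *)
Lemma bilinear_ext (U : lmodType K) (f g : V -> W -> U) :
  bilinear_for *:%R *:%R f -> bilinear_for *:%R *:%R g ->
  (forall i j v w, v \hom i -> w \hom j -> f v w = g v w) ->
  forall v w, f v w = g v w.
Proof.
move=> fb gb efg v w; rewrite -(hcomp_sum v) -(hcomp_sum w).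
rewrite !(bilDl fb) !(bilDl gb) !(bilDr fb) !(bilDr gb).
by rewrite !(efg _ _ _ _ (hcomp_grade _ _) (hcomp_grade _ _)).
Qed.

(** Turns parity into an equation, which an injective map or a nondegenerate form can then test. *)
Lemma homP i (v : V) : reflect (hcomp (~~ i) v = 0) (v \hom i).
Proof.
apply: (iffP idP) => [vi|v0]; first by rewrite (hcompE _ vi); case: i {vi}.
rewrite -(hcomp_sum v).
by case: i v0 => /= ->; rewrite ?add0r ?addr0 hcomp_grade.
Qed.

Lemma even_hcomp (al : 'End(V)) i v :
  even_linear al -> al (hcomp i v) = hcomp i (al v).
Proof.
move=> [_ ale]; rewrite -[in RHS](hcomp_sum v) !linearD /=.
rewrite !(hcompE _ (ale _ _ (hcomp_grade _ v))).
by case: i; rewrite ?addr0 ?add0r.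
Qed.

(** Since [al] commutes with [hcomp], it sends the wrong component of [al^-1 x] to that of [x],
    which is zero; injectivity concludes. *)
Lemma even_linear_inv (al : 'End(V)) :
  lker al == 0%VS -> even_linear al -> even_linear (al^-1)%VF.
Proof.
move=> al0 ale; split=> [|i x xi]; first exact: linearP.
apply/homP; apply: (lker0P al0).
by rewrite even_hcomp // lker0_lfunVK // linear0; apply/homP.
Qed.

End Homogeneous.

(** * Evaluation and separation by the dual superspace *)

Section Dual.
Variables (K : fieldType) (A : superVectType K).
Implicit Types (xi eta : dualv A) (x y v : A).

Lemma dual_evD xi x y : xi (x + y) = xi x + xi y :> K.
Proof. exact: (linearD (xi : 'Hom(A, K^o))). Qed.
Lemma dual_evN xi x : xi (- x) = - xi x :> K.
Proof. exact: (linearN (xi : 'Hom(A, K^o))). Qed.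
Lemma dual_evZ xi a x : xi (a *: x) = a * xi x :> K.
Proof. exact: (linearZ_LR (xi : 'Hom(A, K^o))). Qed.
Lemma dual_ev0 xi : xi 0 = 0 :> K.
Proof. exact: (linear0 (xi : 'Hom(A, K^o))). Qed.
Lemma dual_addE xi eta x : (xi + eta) x = xi x + eta x :> K.
Proof. exact: (add_lfunE (xi : 'Hom(A, K^o)) eta). Qed.
Lemma dual_oppE xi x : (- xi) x = - xi x :> K.
Proof. exact: (opp_lfunE (xi : 'Hom(A, K^o))). Qed.
Lemma dual_scaleE a xi x : (a *: xi) x = a * xi x :> K.
Proof. exact: (scale_lfunE _ (xi : 'Hom(A, K^o))). Qed.
Definition dualE :=
  (dual_addE, dual_oppE, dual_scaleE, dual_evD, dual_evN, dual_evZ).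

Lemma dual_ext xi eta :
  (forall i x, x \hom i -> xi x = eta x :> K) -> xi = eta.
Proof.
move=> e; apply/lfunP => x; rewrite -(hcomp_sum x) !linearD /=.
by rewrite !(e _ _ (hcomp_grade _ _)).
Qed.

(** Coordinates in a basis are linear forms. Applying an arbitrary form turns a vector identity into
    a scalar one, within reach of [ring]. *)
Lemma dual_separates x y : (forall xi, xi x = xi y :> K) -> x = y.
Proof.
move=> e; rewrite (coord_vbasis (memvf x)) (coord_vbasis (memvf y)).
apply: eq_bigr => i _; congr (_ *: _).
have := e (linfun (coord (vbasis fullv) i : A -> K^o) : 'Hom(A, K^o)).
by rewrite !lfunE.
Qed.

(** Any form precomposed with the projection [hcomp i] becomes a form of parity [i] with the same
    value at [x]. *)
Lemma dual_separates_hom i x :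
  x \hom i -> (forall xi, xi \hom i -> xi x = 0 :> K) -> x = 0.
Proof.
move=> xi_i e; apply: dual_separates => xi; rewrite dual_ev0.
pose eta : dualv A := ((xi : 'Hom(A, K^o)) \o hcomp i)%VF.
have etaE v : eta v = xi (hcomp i v) :> K by rewrite /eta comp_lfunE.
have /e : eta \hom i.
  apply/mem_dual_grade => v vi; rewrite etaE (hcompE _ vi).
  by case: i {xi_i e eta etaE vi} => /=; rewrite dual_ev0.
by rewrite etaE (hcompE _ xi_i) eqxx.
Qed.

End Dual.

(** [linfun] accepts any function but need not evaluate back to it unless it is linear; here
    linearity is a proof, not a canonical structure. *)
Lemma linfun_linearE (K : fieldType) (U V : vectType K) (f : U -> V) :
  linear f -> linfun f =1 f.
Proof.
move=> fl u; pose h := GRing.isLinear.Build K U V *:%R f fl.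
by pose F : {linear U -> V} := HB.pack f h; rewrite -[f]/(F : U -> V) lfunE.
Qed.

(** * Bilinear forms and representation of linear forms *)

Section Forms.
Variables (K : fieldType) (A : superVectType K) (B : A -> A -> K).
Hypothesis Bb : bilinear_for *%R *%R B.

Lemma form_bilinear : bilinear_for *:%R *:%R (B : A -> A -> K^o).
Proof. exact: Bb. Qed.

Lemma bformDl x y z : B (x + y) z = B x z + B y z :> K.
Proof. exact: bilDl form_bilinear _ _ _. Qed.
Lemma bformDr x y z : B x (y + z) = B x y + B x z :> K.
Proof. exact: bilDr form_bilinear _ _ _. Qed.
Lemma bformNl x z : B (- x) z = - B x z :> K.
Proof. exact: bilNl form_bilinear _ _. Qed.
Lemma bformNr x z : B x (- z) = - B x z :> K.
Proof. exact: bilNr form_bilinear _ _. Qed.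
Lemma bformZl a x z : B (a *: x) z = a * B x z :> K.
Proof. exact: bilZl form_bilinear _ _ _. Qed.
Lemma bformZr a x z : B x (a *: z) = a * B x z :> K.
Proof. exact: bilZr form_bilinear _ _ _. Qed.
Lemma bform0l z : B 0 z = 0 :> K.
Proof. exact: bil0l form_bilinear _. Qed.
Definition bformE := (bformDl, bformDr, bformNl, bformNr, bformZl, bformZr).

(** Nondegeneracy makes [x |-> B x _] injective; [A] and its dual have the same dimension, so it is
    onto, and [R] is its inverse. *)
Lemma form_riesz :
  (forall x, (forall y, B x y = 0) -> x = 0) ->
  exists R : dualv A -> A, forall (xi : dualv A) z, B (R xi) z = xi z.
Proof.
move=> nd.
pose Phi x : dualv A := linfun (B x : A -> K^o).
have PhiE x z : Phi x z = B x z :> K.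
  by rewrite /Phi linfun_linearE // => a u v; exact: Bb.2.
have Phi_lin : linear Phi.
  by move=> a x y; apply: dual_ext => i z _; rewrite !dualE !PhiE !bformE.
pose F : 'Hom(A, dualv A) := linfun Phi.
have FE x z : F x z = B x z :> K by rewrite /F linfun_linearE.
have F0 : lker F == 0%VS.
  apply/lker0P => x y eF; apply/eqP; rewrite -subr_eq0; apply/eqP/nd => z.
  by rewrite !bformE -!FE eF subrr.
have Ff : limg F = fullv.
  apply/eqP; rewrite eqEdim subvf limg_dim_eq ?(eqP F0) ?capv0 // !dimvf.
  by rewrite /= -[leqRHS]muln1; exact: leqnn.
by exists F^-1%VF => xi z; rewrite -FE limg_lfunVK // Ff memvf.
Qed.

End Forms.

Lemma subadjE (K : fieldType) (A : superVectType K) (op : A -> A -> A) i j x y :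
  even_bilinear op -> x \hom i -> y \hom j ->
  subadj op x y = op x y - ksign i j *: op y x.
Proof. by move=> [opb _] xi yj; rewrite /subadj (koszulE opb yj xi) ksignC. Qed.

Lemma subadj_bilinear (K : fieldType) (A : superVectType K) (op : A -> A -> A) :
  bilinear_for *:%R *:%R op -> bilinear_for *:%R *:%R (subadj op).
Proof.
move=> opb; apply: (bilinearB opb).
exact: (bilinear_flip (koszul_bilinear opb)).
Qed.

(** * The product attached to an invariant nondegenerate cocycle *)

Section CocycleProduct.
Variables (K : fieldType) (A : superVectType K).
Variables (br : A -> A -> A) (al : 'End(A)) (B : A -> A -> K).
Hypothesis char2 : 2%:R != 0 :> K.
Hypotheses (brL : hom_lie br al) (brM : hom_multiplicative br al).
Hypotheses (BC : super_comm_cocycle br al B).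
Hypothesis Bnd : forall x, (forall y, B x y = 0) -> x = 0.
Hypothesis Bal :
  forall i j x y, x \hom i -> y \hom j -> B (al x) (al y) = B x y.

Let Bb : bilinear_for *%R *%R B := (scc_even BC).1.
Let brb : bilinear_for *:%R *:%R br := (hom_lie_br brL).1.
Let br_hom := (hom_lie_br brL).2.
Let al_hom := (hom_lie_al brL).2.

Lemma form_isometry x y : B (al x) (al y) = B x y.
Proof.
rewrite -(hcomp_sum x) -(hcomp_sum y) !linearD /= !(bformE Bb).
by rewrite !(Bal (hcomp_grade _ _) (hcomp_grade _ _)).
Qed.

(** If [al x = al y], invariance makes [x - y] orthogonal to everything. In finite dimension [al^-1]
    is then a two-sided inverse. *)
Lemma isometry_lker0 : lker al == 0%VS.
Proof.
apply/lker0P => x y e; apply/eqP; rewrite -subr_eq0; apply/eqP/Bnd => z.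
by rewrite -form_isometry linearB /= e subrr bform0l.
Qed.

Lemma hom_lie_jacobi_cyclic i j k x y z :
  x \hom i -> y \hom j -> z \hom k ->
  br (al x) (br y z) = - (ksign i j * ksign i k) *: br (al y) (br z x)
                       - (ksign i k * ksign j k) *: br (al z) (br x y).
Proof.
move=> xi yj zk; rewrite (hom_lie_jacobi brL xi yj zk).
rewrite (hom_lie_skew brL (br_hom xi yj) (al_hom zk)) ksignDl.
rewrite (hom_lie_skew brL xi zk) (bilNr brb) (bilZr brb) addrC.
by rewrite scalerN scalerA scaleNr.
Qed.

Lemma hom_lie_jacobi_flip i j k x y z : x \hom i -> y \hom j -> z \hom k ->
  br (br x y) (al z) = br (al x) (br y z) - ksign i j *: br (al y) (br x z).
Proof. by move=> xi yj zk; rewrite (hom_lie_jacobi brL xi yj zk) addrK. Qed.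

(** The cocycle condition at [al z], [br x y], [al w]: multiplicativity merges the two inner [al]
    and invariance removes them from the middle term. *)
Lemma cocycle_bracket_left i j k l x y z w :
  x \hom i -> y \hom j -> z \hom k -> w \hom l ->
  B (al (al z)) (br (br x y) (al w))
  = ksign i k * ksign j k * B (br x y) (br z w)
    - ksign i l * ksign j l * ksign k l * B (al (al w)) (br (al z) (br x y)).
Proof.
move=> xi yj zk wl; have bxy := br_hom xi yj.
have := scc_cocycle BC (al_hom zk) bxy (al_hom wl).
rewrite -(brM wl zk) form_isometry (hom_lie_skew brL wl zk) !(bformE Bb).
rewrite !ksignDr !(ksignC k) !(ksignC l).
have hkl := @ksignK K k l.
by move/(canRL (addrK _))/(canRL (addrK _)) => ->; ring: hkl.
Qed.

(** The cocycle condition at [al z], [al x], [br y w], with [al] removed from the last term in the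
    same way. *)
Lemma cocycle_bracket_right i j k l x y z w :
  x \hom i -> y \hom j -> z \hom k -> w \hom l ->
  B (al (al z)) (br (al x) (br y w))
  = ksign i k * B (al (al x)) (br (al z) (br y w)) - B (br z x) (br y w).
Proof.
move=> xi yj zk wl; have byw := br_hom yj wl.
have := scc_cocycle BC (al_hom zk) (al_hom xi) byw.
rewrite -(brM zk xi) form_isometry (hom_lie_skew brL byw (al_hom zk)).
rewrite (scc_sym BC byw (br_hom zk xi)) !(bformE Bb).
rewrite !ksignDr !ksignDl !(ksignC k).
have hik := @ksignK K i k; have hjk := @ksignK K j k; have hlk := @ksignK K l k.
have hji := @ksignK K j i; have hli := @ksignK K l i.
by move/(canRL (addrK _))/(canRL (addrK _)) => ->; ring: hik hjk hlk hji hli.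
Qed.

(** The square of [al] is onto, so such test vectors suffice. One [al] is used up by the formula for
    the product, the other lets multiplicativity act on the bracket. *)
Lemma form_nondeg_ext u v :
  (forall k w, w \hom k -> B u (al (al w)) = B v (al (al w))) -> u = v.
Proof.
move=> e; apply/eqP; rewrite -subr_eq0; apply/eqP/Bnd => z.
have alVK := lker0_lfunVK isometry_lker0.
rewrite -(alVK z) -(alVK (al^-1%VF z)) -(hcomp_sum (al^-1%VF (al^-1%VF z))).
rewrite !linearD /= !(bformE Bb).
by rewrite -opprD !(e _ _ (hcomp_grade _ _)) subrr.
Qed.

(** The required formula prescribes the pairing with [al z], so the test vector is pulled back by
    [al^-1]; [R] is meant to represent linear forms through [B]. *)
Definition cocycle_product (R : dualv A -> A) (x y : A) : A :=
  R (linfun (fun z => koszul (fun x y =>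
    B (al y) (br x (al^-1%VF z)) : K^o) x y)).

Let kernel_bilinear z :
  bilinear_for *:%R *:%R (fun x y => B (al y) (br x z) : K^o).
Proof.
split=> w a x y /=.
  by rewrite (bilDl brb) (bilZl brb) !(bformE Bb).
by rewrite linearP /= !(bformE Bb).
Qed.

Section Product.
Variable R : dualv A -> A.
Hypothesis RE : forall (xi : dualv A) z, B (R xi) z = xi z.
Let op := cocycle_product R.

Lemma cocycle_product_koszul x y z :
  B (op x y) (al z) = koszul (fun x y => B (al y) (br x z) : K^o) x y.
Proof.
rewrite /op /cocycle_product RE linfun_linearE => [|a u v].
  by rewrite (lker0_lfunK isometry_lker0).
rewrite /koszul scaler_sumr -big_split; apply: eq_bigr => i _ /=.
rewrite scaler_sumr -big_split; apply: eq_bigr => j _ /=.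
rewrite linearP /= (bilDr brb) (bilZr brb) !(bformE Bb).
by rewrite scalerDr; congr (_ + _); rewrite /GRing.scale /= mulrCA.
Qed.

Lemma cocycle_productE i j x y z : x \hom i -> y \hom j ->
  B (op x y) (al z) = ksign i j * B (al y) (br x z).
Proof.
move=> xi yj.
by rewrite cocycle_product_koszul (koszulE (kernel_bilinear z) xi yj).
Qed.

Lemma cocycle_product_bilinear : bilinear_for *:%R *:%R op.
Proof.
have kb z := koszul_bilinear (kernel_bilinear z).
split=> w a x y /=; apply: form_nondeg_ext => k z _.
  rewrite !(bformE Bb) !cocycle_product_koszul.
  by rewrite (bilDl (kb _)) (bilZl (kb _)).
rewrite !(bformE Bb) !cocycle_product_koszul.
by rewrite (bilDr (kb _)) (bilZr (kb _)).
Qed.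

(** To kill the wrong component of [u], test it on [al t]: only the wrong component of [t] matters,
    and on it the formula pairs [al y] with a bracket of parity opposite to [y]. *)
Lemma cocycle_product_even : even_bilinear op.
Proof.
split=> [|i j x y xi yj]; first exact: cocycle_product_bilinear.
set u := op x y; apply/homP/Bnd => z.
have := hcomp_sum (al^-1%VF z); set t := al^-1%VF z => tE.
have -> : z = al t by rewrite lker0_lfunVK ?isometry_lker0.
have ht k : al (hcomp k t) \hom k by apply: al_hom; apply: hcomp_grade.
have hu k := hcomp_grade k u.
rewrite -tE linearD /= (bformDr Bb).
have ev := (scc_even BC).2.
have p0 k l : k != l -> B (hcomp k u) (al (hcomp l t)) = 0.
  by move=> kl; apply: (ev k) => //; case: k l kl (ht l) => -[].
have p1 : B u (al (hcomp (~~ (i (+) j)) t)) = 0.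
  rewrite (cocycle_productE _ xi yj) (ev j) ?mulr0 //; first exact: al_hom.
  have := br_hom xi (hcomp_grade (~~ (i (+) j)) t).
  by rewrite addbN addbA addbb.
move: p1; rewrite -[in B u](hcomp_sum u) (bformDl Bb).
by case: (i (+) j); rewrite (p0 false true) ?(p0 true false) ?add0r ?addr0.
Qed.

Lemma cocycle_product_compatible : compatible op br.
Proof.
apply: (bilinear_ext (subadj_bilinear cocycle_product_bilinear) brb).
move=> i j x y xi yj.
rewrite (subadjE cocycle_product_even xi yj).
apply: form_nondeg_ext => k w wk; have {wk} := al_hom wk.
move: (al w) => {}w wk.
rewrite !(bformE Bb) (cocycle_productE _ xi yj) (cocycle_productE _ yj xi).
have h1 := scc_cocycle BC xi yj wk.
have h2 := scc_sym BC (al_hom wk) (br_hom xi yj).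
have h3 := congr1 (B (al y)) (hom_lie_skew brL wk xi).
move: h1; rewrite h2 h3 !(bformE Bb) !ksignDr !(ksignC j i) !(ksignC k).
have hij := @ksignK K i j; have hik := @ksignK K i k; have hjk := @ksignK K j k.
(* Adding the vanishing cocycle sum cancels both product terms and leaves the pairing of [br x y]
   with [w]. *)
move=> h1; rewrite -[LHS]addr0 -h1; ring: hij hik hjk.
Qed.

Lemma cocycle_product_multiplicative : hom_multiplicative op al.
Proof.
move=> i j x y xi yj; apply: form_nondeg_ext => k w wk.
rewrite form_isometry !(cocycle_productE _ (al_hom xi) (al_hom yj)).
by rewrite (cocycle_productE _ xi yj) -(brM xi wk) form_isometry.
Qed.

(** The defining formula is used twice. In between, multiplicativity of the product and of the
    bracket restores an [al] on the test vector. *)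
Lemma cocycle_product_left_pairing i j k l x y z w :
  x \hom i -> y \hom j -> z \hom k -> w \hom l ->
  B (op (al x) (op y z)) (al (al w))
  = ksign i (j (+) k) * ksign j k * B (al (al z)) (br (al y) (br x w)).
Proof.
move=> xi yj zk wl; have oyz := cocycle_product_even.2 _ _ _ _ yj zk.
rewrite (cocycle_productE _ (al_hom xi) oyz) -mulrA; congr (_ * _).
rewrite (cocycle_product_multiplicative yj zk) -(brM xi wl).
by rewrite (cocycle_productE _ (al_hom yj) (al_hom zk)).
Qed.

Lemma cocycle_product_right_pairing i j k x y z w :
  x \hom i -> y \hom j -> z \hom k ->
  B (op (br x y) (al z)) (al (al w))
  = ksign (i (+) j) k * B (al (al z)) (br (br x y) (al w)).
Proof.
by move=> xi yj zk; rewrite (cocycle_productE _ (br_hom xi yj) (al_hom zk)).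
Qed.

Lemma cocycle_product_hapl : hom_anti_pre_lie op al.
Proof.
split; [exact: cocycle_product_even | exact: hom_lie_al brL | |].
  move=> i j k x y z xi yj zk; rewrite cocycle_product_compatible.
  apply: form_nondeg_ext => l w wl; rewrite !(bformE Bb).
  rewrite (cocycle_product_left_pairing xi yj zk wl).
  rewrite (cocycle_product_left_pairing yj xi zk wl).
  rewrite (cocycle_product_right_pairing _ yj xi zk).
  (* All three pairings have [al (al z)] on the left, so the identity is the Jacobi identity for
     [y], [x], [w] seen through the form. *)
  have := congr1 (B (al (al z))) (hom_lie_jacobi brL yj xi wl).
  rewrite !(bformE Bb) !ksignDr !ksignDl !(ksignC j i).
  move=> h; have hij := @ksignK K i j.
  rewrite h; ring: hij.
move=> i j k x y z xi yj zk; rewrite !cocycle_product_compatible.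
apply: form_nondeg_ext => l w wl; rewrite !(bformE Bb) bform0l //.
rewrite (cocycle_product_right_pairing _ xi yj zk).
rewrite (cocycle_product_right_pairing _ yj zk xi).
rewrite (cocycle_product_right_pairing _ zk xi yj).
rewrite !ksignDr !ksignDl (ksignC k i) (ksignC k j) (ksignC j i).
have hij := @ksignK K i j; have hik := @ksignK K i k; have hjk := @ksignK K j k.
set T := (T in T = 0).
suff TN : T = - T.
  apply/eqP; move/eqP: TN; rewrite -subr_eq0 opprK -mulr2n -mulr_natl mulf_eq0.
  by rewrite (negPf char2).
have jac := congr1 (B (al (al w))) (hom_lie_jacobi_cyclic xi yj zk).
pose Q := B (br x y) (br z w) + ksign i j * ksign i k * B (br y z) (br x w)
  + ksign i k * ksign j k * B (br z x) (br y w).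
(* First evaluation, cocycle condition first: the leftover pairings with [al (al w)] add up to the
   cyclic Jacobi sum and vanish. *)
have TQ : T = Q.
  rewrite /T /Q (cocycle_bracket_left xi yj zk wl).
  rewrite (cocycle_bracket_left yj zk xi wl) (cocycle_bracket_left zk xi yj wl).
  rewrite jac !(bformE Bb) (ksignC k i) (ksignC k j) (ksignC j i).
  ring: hij hik hjk.
(* Second evaluation, Jacobi first: of the six resulting terms, the cocycle condition turns three
   into cancelling copies of the others, leaving [- Q]. *)
rewrite {2}TQ /T (hom_lie_jacobi_flip xi yj wl) (hom_lie_jacobi_flip yj zk wl).
rewrite (hom_lie_jacobi_flip zk xi wl) !(bformE Bb).
rewrite (cocycle_bracket_right xi yj zk wl) (cocycle_bracket_right yj zk xi wl).
rewrite (cocycle_bracket_right zk xi yj wl).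
rewrite /Q (ksignC k i) (ksignC k j) (ksignC j i).
ring: hij hik hjk.
Qed.

End Product.
End CocycleProduct.

Lemma nondegenerate_cocycle_product (K : fieldType) (A : superVectType K)
    (br : A -> A -> A) (al : 'End(A)) (B : A -> A -> K) :
  2%:R != 0 :> K -> hom_lie br al -> hom_multiplicative br al ->
  super_comm_cocycle br al B -> (forall x, (forall y, B x y = 0) -> x = 0) ->
  (forall i j x y, x \hom i -> y \hom j -> B (al x) (al y) = B x y) ->
  exists op : A -> A -> A,
    [/\ hom_anti_pre_lie op al,
        compatible op br
      & forall i j k x y z, x \hom i -> y \hom j -> z \hom k ->
          B (op x y) (al z) = ksign i j * B (al y) (br x z)].
Proof.
move=> char2 brL brM BC Bnd Bal.
have [R RE] := form_riesz (scc_even BC).1 Bnd.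
exists (cocycle_product br al B R); split.
- exact: cocycle_product_hapl.
- exact: cocycle_product_compatible.
- by move=> i j k x y z xi yj _; exact: cocycle_productE.
Qed.

(** * The natural form on the sum of a superspace and its dual *)

Section NaturalForm.
Variables (K : fieldType) (A : superVectType K).
Local Notation Bd := (@natural_form K A).

Lemma natural_form_bilinear : bilinear_for *%R *%R Bd.
Proof.
have eb : bilinear_for *:%R *:%R (fun (x : A) (zeta : dualv A) => zeta x : K^o).
  by split=> [zeta|x] a u v; rewrite !dualE.
have kb := koszul_bilinear eb; split=> w a x y; rewrite /natural_form /=.
  rewrite (bilDl kb) (bilZl kb) dual_addE dual_scaleE.
  by rewrite addrACA mulrDr.
rewrite (bilDr kb) (bilZr kb) dual_evD dual_evZ.
by rewrite addrACA mulrDr.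
Qed.

Lemma natural_form_sym i j p q : p \hom i -> q \hom j ->
  Bd p q = ksign i j * Bd q p.
Proof.
move=> ph qj; rewrite (natural_formE ph qj) (natural_formE qj ph) (ksignC j i).
by have hij := @ksignK K i j; ring: hij.
Qed.

Lemma natural_form_even i p q : p \hom i -> q \hom (~~ i) -> Bd p q = 0.
Proof.
move=> ph qi; rewrite (natural_formE ph qi).
move: ph qi; rewrite !mem_pair_grade => /andP[p1 p2] /andP[q1 q2].
move/mem_dual_grade: p2 => /(_ _ q1) ->.
have p1' : p.1 \hom (~~ ~~ i) by rewrite negbK.
by move/mem_dual_grade: q2 => /(_ _ p1') ->; rewrite mulr0 addr0.
Qed.

(** Testing on [(0, zeta)] kills the vector part of [p], testing on [(x, 0)] its dual part. *)
Lemma natural_form_nondeg_hom i p : p \hom i ->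
  (forall q, q \hom i -> Bd p q = 0) -> p = 0.
Proof.
move=> ph e; have := ph; rewrite mem_pair_grade => /andP[p1 p2].
apply: injective_projections => /=.
  apply: (dual_separates_hom p1) => zeta zi.
  have qi : (0 : A, zeta) \hom i by rewrite mem_pair_grade mem0v.
  have := e _ qi; rewrite (natural_formE ph qi) /= dual_ev0 addr0.
  move/(congr1 (fun t => ksign i i * t)).
  by rewrite mulrA ksignK mul1r mulr0.
apply: dual_ext => j x xj; rewrite [RHS]zero_lfunE.
case: (eqVneq j i) => [ji|nji]; last first.
  by move/mem_dual_grade: p2; apply; case: i j nji xj {ph e p1} => -[].
subst j; have qi : (x, 0 : dualv A) \hom i by rewrite mem_pair_grade xj mem0v.
have := e _ qi; rewrite (natural_formE ph qi) /= zero_lfunE.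
by rewrite mulr0 add0r.
Qed.

(** The form is even, so pairing with a homogeneous vector sees only the component of that parity,
    and the homogeneous case applies to each component. *)
Lemma natural_form_nondegenerate : nondegenerate_form Bd.
Proof.
have Bb := natural_form_bilinear.
have hcl i p q : q \hom i -> Bd (hcomp i p) q = Bd p q.
  move=> qi; rewrite -[in RHS](hcomp_sum p) (bformDl Bb).
  case: i qi => qi.
    by rewrite (natural_form_even (hcomp_grade false p) qi) add0r.
  by rewrite (natural_form_even (hcomp_grade true p) qi) addr0.
have hcr i p q : p \hom i -> Bd p (hcomp i q) = Bd p q.
  move=> ph; rewrite -[in RHS](hcomp_sum q) (bformDr Bb).
  case: i ph => ph.
    by rewrite (natural_form_even ph (hcomp_grade false q)) add0r.
  by rewrite (natural_form_even ph (hcomp_grade true q)) addr0.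
have sep p : (forall i q, q \hom i -> Bd (hcomp i p) q = 0) -> p = 0.
  move=> e; rewrite -(hcomp_sum p).
  by rewrite !(natural_form_nondeg_hom (hcomp_grade _ p) (e _)) addr0.
split=> p e; apply: sep => i q qi; first by rewrite hcl.
by rewrite (natural_form_sym (hcomp_grade i p) qi) hcr // e mulr0.
Qed.

End NaturalForm.

(** * The sub-adjacent Hom-Lie superalgebra *)

Section AntiPreLie.
Variables (K : fieldType) (A : superVectType K).
Variables (op : A -> A -> A) (al : 'End(A)).
Hypotheses (opL : hom_anti_pre_lie op al) (opM : hom_multiplicative op al).

Let op_even : even_bilinear op := hapl_op opL.
Let opb : bilinear_for *:%R *:%R op := (hapl_op opL).1.
Let op_hom := (hapl_op opL).2.
Let al_hom := (hapl_al opL).2.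

Lemma subadj_hom i j x y :
  x \hom i -> y \hom j -> subadj op x y \hom (i (+) j).
Proof.
move=> xi yj; rewrite (subadjE op_even xi yj) rpredB ?op_hom //.
by rewrite rpredZ // addbC op_hom.
Qed.

Lemma subadj_skew i j x y : x \hom i -> y \hom j ->
  subadj op x y = - (ksign i j *: subadj op y x).
Proof.
move=> xi yj; rewrite (subadjE op_even xi yj) (subadjE op_even yj xi).
by rewrite scalerBr scalerA (ksignC j i) ksignK scale1r opprB.
Qed.

(** The Jacobi identity, fully expanded, is a combination of three instances of the left identity
    and the cyclic identity. *)
Lemma subadj_hom_lie : hom_lie (subadj op) al.
Proof.
split; [split=> [|i j x y xi yj] | exact: hapl_al opL | exact: subadj_skew |].
- exact: subadj_bilinear.
- exact: subadj_hom.
move=> i j k x y z xi yj zk; apply: dual_separates => zeta.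
have left3 := fun i j k x y z xi yj zk =>
  congr1 (zeta : A -> K) (@hapl_left _ _ _ _ opL i j k x y z xi yj zk).
have hxyz := left3 _ _ _ _ _ _ xi yj zk.
have hyzx := left3 _ _ _ _ _ _ yj zk xi.
have hxzy := left3 _ _ _ _ _ _ xi zk yj.
have := congr1 (zeta : A -> K) (hapl_cyclic opL xi yj zk).
move: hxyz hyzx hxzy.
(* Brackets are oriented as [[x, y]], [[y, z]], [[z, x]], the shape in the cyclic identity, so that
   the relations share their monomials. *)
rewrite (subadj_skew yj xi) (subadj_skew zk yj).
rewrite (subadjE op_even (al_hom xi) (subadj_hom yj zk)).
rewrite (subadjE op_even (subadj_hom xi yj) (al_hom zk)).
rewrite (subadjE op_even (al_hom yj) (subadj_hom xi zk)).
rewrite (subadj_skew xi zk).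
have e i' j' x' y' w' (hx : x' \hom i') (hy : y' \hom j') :
    op w' (subadj op x' y') = op w' (op x' y') - ksign i' j' *: op w' (op y' x').
  by rewrite (subadjE op_even hx hy) (bilDr opb) (bilNr opb) (bilZr opb).
rewrite (e _ _ _ _ (al x) yj zk) (e _ _ _ _ (al z) xi yj).
rewrite (bilNr opb) (bilZr opb) (e _ _ _ _ (al y) zk xi).
rewrite !(bilNl opb) !(bilZl opb) !dualE dual_ev0.
rewrite !ksignDr !ksignDl (ksignC k i) (ksignC k j) (ksignC j i).
have hij := @ksignK K i j; have hik := @ksignK K i k; have hjk := @ksignK K j k.
move=> /(canRL (addrNK _)) h1 /(canRL (addrNK _)) h2 /(canRL (addrNK _)) h3.
move=> /(canRL (addrK _)) /(canRL (addrK _)) h4.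
rewrite h1 h2 h3 h4.
ring: hij hik hjk.
Qed.

(** * The semidirect product for a bijective twisting map *)

Hypothesis al_bij : bijective al.

Let al0 : lker al == 0%VS.
Proof. by apply/lker0P; exact: bij_inj al_bij. Qed.
Let alK : cancel al (al^-1)%VF := lker0_lfunK al0.
Let alVK : cancel (al^-1)%VF al := lker0_lfunVK al0.
Let alV_hom : forall i x, x \hom i -> al^-1%VF x \hom i :=
  (even_linear_inv al0 (hapl_al opL)).2.

(** Writing arguments as images under [al] is how the inverse powers of [al] in [Lstar] are
    eliminated. *)
Lemma hom_preimage i x : x \hom i -> exists2 y, y \hom i & x = al y.
Proof. by move=> xi; exists (al^-1%VF x); [exact: alV_hom | rewrite alVK]. Qed.

(** Valid for all vectors, multiplicativity rewrites without parity side conditions. *)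
Lemma hapl_morph x y : al (op x y) = op (al x) (al y).
Proof.
apply: (bilinear_ext (f := fun x y => al (op x y))
                     (g := fun x y => op (al x) (al y))) x y => //.
- split=> w a x y /=; first by rewrite (bilDl opb) (bilZl opb) linearP.
  by rewrite (bilDr opb) (bilZr opb) linearP.
- split=> w a x y /=; rewrite linearP /=.
    by rewrite (bilDl opb) (bilZl opb).
  by rewrite (bilDr opb) (bilZr opb).
Qed.

Lemma subadj_morph i j x y : x \hom i -> y \hom j ->
  al (subadj op x y) = subadj op (al x) (al y).
Proof.
move=> xi yj; rewrite !(subadjE op_even (al_hom xi) (al_hom yj)).
by rewrite (subadjE op_even xi yj) linearB linearZ /= !hapl_morph.
Qed.

Lemma Lstar_bilinear : bilinear_for *:%R *:%R (Lstar op al).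
Proof.
apply: bilinearN; apply: koszul_bilinear.
have opE u : linfun (op u) =1 op u.
  by apply: linfun_linearE => a x y; exact: opb.2.
have E u (eta : dualv A) v :
    (eta \o linfun (op (al^-1%VF u)) \o (al^-1 \o al^-1))%VF v
    = eta (op (al^-1%VF u) (al^-1%VF (al^-1%VF v))) :> K.
  by rewrite !comp_lfunE opE.
split=> w a x y /=; apply: dual_ext => i v _; rewrite !dualE !E //.
  by rewrite linearP /= (bilDl opb) (bilZl opb) !dualE.
by rewrite !dualE.
Qed.

(** For [v] of the parity opposite to [i (+) j], the product inside [Lstar] has parity [~~ j], where
    [xi] vanishes. *)
Lemma Lstar_hom i j x (xi : dualv A) :
  x \hom i -> xi \hom j -> Lstar op al x xi \hom (i (+) j).
Proof.
move=> x_i xi_j; apply/mem_dual_grade => v vij.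
rewrite (LstarE _ _ op_even x_i xi_j).
have := op_hom (alV_hom x_i) (alV_hom (alV_hom vij)).
rewrite addbN addbA addbb addFb => h.
by move/mem_dual_grade: xi_j => /(_ _ h) ->; rewrite mulr0 oppr0.
Qed.

Lemma semi_br_bilinear : bilinear_for *:%R *:%R (semi_br op al).
Proof.
have sb := subadj_bilinear opb; have Lb := Lstar_bilinear.
have kb := koszul_bilinear Lb.
have dist a (u v u' v' : dualv A) :
    - (a *: u + v) + (a *: u' + v') = a *: (- u + u') + (- v + v').
  by rewrite scalerDr scalerN opprD addrACA.
split=> w a x y /=; congr pair => /=.
- by rewrite (bilDl sb) (bilZl sb).
- by rewrite (bilDl Lb) (bilZl Lb) (bilDr kb) (bilZr kb); apply: dist.
- by rewrite (bilDr sb) (bilZr sb).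
- by rewrite (bilDr Lb) (bilZr Lb) (bilDl kb) (bilZl kb); apply: dist.
Qed.

(** In the [p.2] term the outer Koszul sign cancels the one inside [Lstar]. *)
Lemma semi_br_dualE i j (p q : A * dualv A) v : p \hom i -> q \hom j ->
  (semi_br op al p q).2 v
  = ksign i j * q.2 (op (al^-1%VF p.1) (al^-1%VF (al^-1%VF v)))
    - p.2 (op (al^-1%VF q.1) (al^-1%VF (al^-1%VF v))) :> K.
Proof.
rewrite !mem_pair_grade => /andP[p1 p2] /andP[q1 q2] /=.
rewrite (koszulE Lstar_bilinear q1 p2) dual_addE dual_scaleE dual_oppE.
rewrite (LstarE _ _ op_even p1 q2) (LstarE _ _ op_even q1 p2) !(ksignC j i).
by have hij := @ksignK K i j; ring: hij.
Qed.

Lemma semi_br_hom i j p q :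
  p \hom i -> q \hom j -> semi_br op al p q \hom (i (+) j).
Proof.
rewrite !mem_pair_grade => /andP[p1 p2] /andP[q1 q2]; rewrite subadj_hom //=.
rewrite (koszulE Lstar_bilinear q1 p2).
apply: rpredD; first by rewrite rpredN; apply: Lstar_hom.
by rewrite addbC; apply: rpredZ; apply: Lstar_hom.
Qed.

Lemma semi_al_hom i p : p \hom i -> semi_al al p \hom i.
Proof.
rewrite !mem_pair_grade => /andP[p1 p2]; rewrite al_hom //=.
apply/mem_dual_grade => v vi; rewrite comp_lfunE.
by move/mem_dual_grade: p2; apply; apply: alV_hom.
Qed.

Lemma semi_al_linear : linear (semi_al al).
Proof.
move=> a x y; congr pair => /=; first by rewrite linearP.
by rewrite comp_lfunDl comp_lfunZl.
Qed.

Lemma semi_br_skew i j p q : p \hom i -> q \hom j ->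
  semi_br op al p q = - (ksign i j *: semi_br op al q p).
Proof.
move=> ph qj; have := ph; have := qj.
rewrite !mem_pair_grade => /andP[q1 _] /andP[p1 _].
have skew2 : (semi_br op al p q).2 = - (ksign i j *: (semi_br op al q p).2).
  apply: dual_ext => k v _; rewrite dual_oppE dual_scaleE.
  rewrite (semi_br_dualE _ ph qj) (semi_br_dualE _ qj ph) (ksignC j i).
  by have hij := @ksignK K i j; ring: hij.
by apply: injective_projections; [exact: subadj_skew | exact: skew2].
Qed.

Lemma semi_br_jacobi i j k p q r : p \hom i -> q \hom j -> r \hom k ->
  semi_br op al (semi_al al p) (semi_br op al q r)
  = semi_br op al (semi_br op al p q) (semi_al al r)
    + ksign i j *: semi_br op al (semi_al al q) (semi_br op al p r).
Proof.
move=> ph qj rk.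
have pq := semi_br_hom ph qj; have pr := semi_br_hom ph rk.
have qr := semi_br_hom qj rk.
have api := semi_al_hom ph; have aqj := semi_al_hom qj.
have ark := semi_al_hom rk.
have jac2 : (semi_br op al (semi_al al p) (semi_br op al q r)).2
  = (semi_br op al (semi_br op al p q) (semi_al al r)).2
    + ksign i j *: (semi_br op al (semi_al al q) (semi_br op al p r)).2.
  apply: dual_ext => l v vl; rewrite dual_addE dual_scaleE.
  rewrite (semi_br_dualE _ api qr) (semi_br_dualE _ pq ark).
  rewrite (semi_br_dualE _ aqj pr) (semi_br_dualE _ ph qj).
  rewrite (semi_br_dualE _ ph rk) (semi_br_dualE _ qj rk).
  case: p q r ph qj rk {pq pr qr api aqj ark} => [x xi] [y eta] [z zeta].
  rewrite !mem_pair_grade /= => /andP[x_i _] /andP[y_j _] /andP[z_k _].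
  (* Two nested brackets involve at most [al^-2] on [x], [y], [z] and [al^-4] on [v], hence two
     preimages for each of the former and four for the latter. *)
  have [x1 x1i ->] := hom_preimage x_i; have [X Xi ->] := hom_preimage x1i.
  have [y1 y1j ->] := hom_preimage y_j; have [Y Yj ->] := hom_preimage y1j.
  have [z1 z1k ->] := hom_preimage z_k; have [Z Zk ->] := hom_preimage z1k.
  have [v1 v1l ->] := hom_preimage vl; have [v2 v2l ->] := hom_preimage v1l.
  have [v3 v3l ->] := hom_preimage v2l; have [V Vl ->] := hom_preimage v3l.
  rewrite -!(subadj_morph (al_hom Xi) (al_hom Yj)) -!(subadj_morph Xi Yj).
  rewrite -!(subadj_morph (al_hom Xi) (al_hom Zk)) -!(subadj_morph Xi Zk).
  rewrite -!(subadj_morph (al_hom Yj) (al_hom Zk)) -!(subadj_morph Yj Zk).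
  rewrite !comp_lfunE !alK -!hapl_morph !alK.
  (* The terms in each of [xi], [eta], [zeta] form one left identity, for the other two arguments
     acting on [V]. *)
  have left3 i0 j0 x0 y0 (phi : dualv A) (hx : x0 \hom i0) (hy : y0 \hom j0) :=
    congr1 (phi : A -> K) (hapl_left opL hx hy Vl).
  move: (left3 _ _ _ _ xi Zk Yj) (left3 _ _ _ _ eta Zk Xi).
  move: (left3 _ _ _ _ zeta Yj Xi).
  rewrite !dualE !ksignDr !ksignDl !(ksignC k i) !(ksignC k j) !(ksignC j i).
  have hij := @ksignK K i j; have hik := @ksignK K i k; have hjk := @ksignK K j k.
  do 3![move/(canRL (addrNK _)) => ->].
  ring: hij hik hjk.
apply: injective_projections; last exact: jac2.
have := ph; have := qj; have := rk.
rewrite !mem_pair_grade => /andP[r1 _] /andP[q1 _] /andP[p1 _].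
exact: (hom_lie_jacobi subadj_hom_lie p1 q1 r1).
Qed.

Lemma semi_hom_lie : hom_lie (semi_br op al) (semi_al al).
Proof.
split.
- by split; [exact: semi_br_bilinear | exact: semi_br_hom].
- by split; [exact: semi_al_linear | exact: semi_al_hom].
- exact: semi_br_skew.
- exact: semi_br_jacobi.
Qed.

(** * The cocycle condition for the natural form *)

Lemma natural_form_cocycle :
  super_comm_cocycle (semi_br op al) (semi_al al) (@natural_form K A).
Proof.
split.
- by split; [exact: natural_form_bilinear | exact: natural_form_even].
- exact: natural_form_sym.
move=> i j k p q r ph qj rk.
have pq := semi_br_hom ph qj; have qr := semi_br_hom qj rk.
have rp := semi_br_hom rk ph.
have api := semi_al_hom ph; have aqj := semi_al_hom qj.
have ark := semi_al_hom rk.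
rewrite (natural_formE api qr) (natural_formE aqj rp) (natural_formE ark pq).
rewrite (semi_br_dualE _ ph qj) (semi_br_dualE _ qj rk) (semi_br_dualE _ rk ph).
case: p q r ph qj rk {pq qr rp api aqj ark} => [x xi] [y eta] [z zeta].
rewrite !mem_pair_grade /= => /andP[x_i _] /andP[y_j _] /andP[z_k _].
(* One preimage each is enough: [semi_al] already supplies one [al] against the [al^-2] of
   [Lstar]. *)
have [X Xi ->] := hom_preimage x_i; have [Y Yj ->] := hom_preimage y_j.
have [Z Zk ->] := hom_preimage z_k.
rewrite -(subadj_morph Xi Yj) -(subadj_morph Yj Zk) -(subadj_morph Zk Xi).
rewrite !comp_lfunE !alK (subadjE op_even Xi Yj) (subadjE op_even Yj Zk).
rewrite (subadjE op_even Zk Xi) !dualE.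
rewrite !ksignDr !(ksignC k i) !(ksignC k j) !(ksignC j i).
have hij := @ksignK K i j; have hik := @ksignK K i k; have hjk := @ksignK K j k.
ring: hij hik hjk.
Qed.

End AntiPreLie.

Theorem corollary3p4 (K : fieldType) (charK : [pchar K] =i pred0) :
  (forall (A : superVectType K) (br : A -> A -> A) (al : 'End(A))
      (B : A -> A -> K),
    hom_lie br al -> hom_multiplicative br al ->
    super_comm_cocycle br al B -> nondegenerate_form B ->
    (forall i j x y, x \hom i -> y \hom j -> B (al x) (al y) = B x y) ->
    exists op : A -> A -> A,
      [/\ hom_anti_pre_lie op al,
          compatible op br
        & forall i j k x y z, x \hom i -> y \hom j -> z \hom k ->
            B (op x y) (al z) = ksign i j * B (al y) (br x z)])
  /\
  (forall (A : superVectType K) (op : A -> A -> A) (al : 'End(A)),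
    hom_anti_pre_lie op al -> hom_multiplicative op al -> bijective al ->
    [/\ hom_lie (semi_br op al) (semi_al al),
        nondegenerate_form (@natural_form K A)
      & super_comm_cocycle (semi_br op al) (semi_al al) (@natural_form K A)]).
Proof.
(* Used to conclude [T = 0] from [T = - T] in the cyclic identity. *)
have char2 : 2%:R != 0 :> K by rewrite (pcharf0P _).1.
split=> [A br al B brL brM BC [Bnd _] Bal | A op al opL opM al_bij].
  exact: nondegenerate_cocycle_product.
split; first exact: semi_hom_lie.
  exact: natural_form_nondegenerate.
exact: natural_form_cocycle.
Qed.
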